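(* The following hold. (i) Let $\mathfrak{T}$ be a locally finite tree in which every vertex $x$ has a finite number $\nu(x)\ge 3$ of neighbours, and let $\omega$ be a fixed geodesic ray in $\mathfrak{T}$. Then the operator $\mathcal{B}$ is bounded on $L^p(\mathfrak{T})$ for every $p\in[1,\infty]$; the operator $\mathcal{B}^u$ is bounded on $L^p(\mathfrak{T})$ for every $p\in(1,\infty]$, and it satisfies the weak type estimate $$\big|\{x\in\mathfrak{T}:\mathcal{B}^uf(x)>\alpha\}\big|\le\frac{2}{\alpha}\,\|f\|_1\qquad\text{for all }\alpha>0\text{ and all } f\in L^1(\mathfrak{T}).$$ (ii) For every integer $b\ge2$, the operator $\mathcal{B}^u$ is unbounded on $L^1(\mathfrak{T}_b)$.
   Context: A tree is a connected graph with no loops (cycles); it is identified with its set of vertices, endowed with the graph distance $d$ and the counting measure $\mu$; $|E|$ denotes the cardinality of $E\subseteq\mathfrak{T}$, and $L^p(\mathfrak{T})=L^p(\mathfrak{T},\mu)$. The number $\nu(x)$ of neighbours of $x$ is finite for every $x$, but $\nu$ need not be bounded on $\mathfrak{T}$. For an integer $b\ge2$, $\mathfrak{T}_b$ denotes the homogeneous tree, in which every vertex has exactly $b+1$ neighbours. A geodesic ray is a sequence $\omega=\{x_m:m\in\mathbb{N}\}$ of vertices with $d(x_i,x_j)=|i-j|$ for all $i,j$. In each tree under consideration, fix such a ray $\omega$. The height function is $h(x)=\lim_{m\to\infty}\big(m-d(x,x_m)\big)\in\mathbb{Z}$. Each vertex $x$ has exactly one neighbour of height $h(x)+1$, and its other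 $\nu(x)-1$ neighbours, called the successors of $x$, have height $h(x)-1$. Let $s^0(x)=\{x\}$, let $s^1(x)$ be the set of successors of $x$, and $s^k(x)=\bigcup_{y\in s^{k-1}(x)}s^1(y)$ for $k\ge2$. For an integer $R\ge0$, the triangle with vertex $x$ and height $R$ is $T_R(x)=\bigcup_{j=0}^R s^j(x)$; a triangle is any set of this form. The base of the triangle $T=T_R(x)$ is $\beta(T)=s^R(x)$. The maximal operators are $$\mathcal{B}f(x)=\sup_{r\in\mathbb{N}}\frac{1}{|s^r(x)|}\int_{s^r(x)}|f|\,d\mu\qquad\text{and}\qquad \mathcal{B}^uf(x)=\sup_{T\ni x}\frac{1}{|\beta(T)|}\int_{\beta(T)}|f|\,d\mu,$$ where $\mathbb{N}$ includes $0$ and $T$ ranges over all triangles containing $x$. An operator $S$ of this kind is bounded on $L^p$ if there is a constant $C$ with $\|Sf\|_p\le C\|f\|_p$ for all $f\in L^p$, and unbounded on $L^p$ otherwise. *)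

(* Defs.v *)
From HB Require Import structures.
From mathcomp Require Import all_boot all_order all_algebra finmap.
From mathcomp Require Import all_classical all_reals all_analysis.

Set Implicit Arguments.
Unset Strict Implicit.
Unset Printing Implicit Defensive.

Import Order.TTheory GRing.Theory Num.Theory.
Import numFieldNormedType.Exports.

Local Open Scope classical_set_scope.
Local Open Scope ring_scope.

(* [V] with the sigma-algebra of all its subsets. *)
Definition discrete_space (V : Type) : Type := V.

HB.instance Definition _ (V : pointedType) := Pointed.on (discrete_space V).
HB.instance Definition _ (V : pointedType) :=
  @isMeasurable.Build default_measure_display (discrete_space V)
    discrete_measurable discrete_measurable0
    discrete_measurableC discrete_measurableU.

Definition vertex_measure (R : realType) (V : pointedType) :
    {measure set (discrete_space V) -> \bar R} :=
  @counting (discrete_space V) R.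

Section tree.
Context (V : pointedType) (adj : rel V).

(* The bound on [size c] discards the degenerate cycles [:: x; y] given by
   an edge traversed back and forth. *)
Definition is_tree : Prop :=
  [/\ symmetric adj, irreflexive adj,
      forall x y : V, exists2 p : seq V, path adj x p & last x p = y
    & forall c : seq V, ucycle adj c -> (size c < 3)%N].

Definition neighbours (x : V) : set V := [set y | adj x y].

Definition locally_finite : Prop := forall x, finite_set (neighbours x).

(* [fset_set] is the empty set on infinite sets: [degree] is meaningful
   for locally finite graphs only. *)
Definition degree (x : V) : nat := #|` fset_set (neighbours x)|.

Definition joined_by (x y : V) (n : nat) : Prop :=
  exists p : seq V, [/\ path adj x p, last x p = y & size p = n].

Definition gdist (x y : V) : nat :=
  xget 0%N [set n | joined_by x y n /\
                    forall m, joined_by x y m -> (n <= m)%N].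

Definition geodesic_ray (omega : nat -> V) : Prop :=
  forall i j : nat, gdist (omega i) (omega j) = `|i - j|%N.

Section operators.
Context (R : realType) (omega : nat -> V).

(* The sequence is eventually constant along a geodesic ray of a connected
   graph, so that the limit is an integer, here seen in [R]. *)
Definition height (x : V) : R :=
  lim ((fun m : nat => m%:R - (gdist x (omega m))%:R : R) @ \oo).

Definition successors (x : V) : set V :=
  [set y | adj x y /\ height y = height x - 1].

Fixpoint nsuccessors (k : nat) (x : V) : set V :=
  if k is k'.+1 then \bigcup_(y in nsuccessors k' x) successors y
  else [set x].

Definition triangle (r : nat) (x : V) : set V :=
  \bigcup_(j in [set j : nat | (j <= r)%N]) nsuccessors j x.

Local Open Scope ereal_scope.

Definition average (f : V -> R) (A : set V) : \bar R :=
  (vertex_measure R V A)^-1 * \int[vertex_measure R V]_(y in A) `|(f y)%:E|.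

Definition base_maximal (f : V -> R) (x : V) : \bar R :=
  ereal_sup [set average f (nsuccessors r x) | r in [set: nat]].

(* Triangles are indexed by their vertex and height, [yr = (y, r)] standing
   for [triangle r y], whose base is [nsuccessors r y]. *)
Definition uncentred_base_maximal (f : V -> R) (x : V) : \bar R :=
  ereal_sup [set average f (nsuccessors yr.2 yr.1) |
              yr in [set yr : V * nat | triangle yr.2 yr.1 x]].

End operators.

End tree.

Definition bounded_on_Lp (R : realType) (V : pointedType) (p : \bar R)
    (S : (V -> R) -> V -> \bar R) : Prop :=
  exists C : R, forall f : discrete_space V -> R,
    f \in Lfun (vertex_measure R V) p ->
    ('N[vertex_measure R V]_p[S f]
       <= C%:E * 'N[vertex_measure R V]_p[EFin \o f])%E.

(* Main.v *)
Require Import Defs.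
From mathcomp Require Import all_boot all_order all_algebra finmap.
From mathcomp Require Import all_classical all_reals all_analysis.
From mathcomp Require Import ess_sup_inf.
From mathcomp Require Import zify ring lra.

Set Implicit Arguments.
Unset Strict Implicit.
Unset Printing Implicit Defensive.

Import Order.TTheory GRing.Theory Num.Theory.
Import numFieldNormedType.Exports.

Local Open Scope classical_set_scope.
Local Open Scope ring_scope.

(** For a fixed ray, the tree is the graph of a "parent" map that raises the
    height by 1: the neighbours [y] of [x] with [h y >= h x] are joined by a
    path avoiding [x] (through a far point of the ray), hence coincide.  The
    base of a triangle is then a set of [k]-th descendants, and has at least
    [2^k] elements.

    Let [M f z] be the supremum of the averages of [|f|] over the bases that
    contain [z]; on each level of the tree it is a martingale maximal function.
    If a triangle contains [x] and its base contains the [k]-th descendants of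
    [x], its average is at most [M f z] for every such descendant [z].  So, for
    nondecreasing [phi >= 0], [phi (B^u f x)] is at most the sum over [k] of the
    averages of [phi (M f)] over the [k]-th descendants of [x]; summed over [x]
    this is at most [2 \sum_z phi (M f z)], because [2^-k] sums to [2].  The
    power [phi s = s^p] and Doob's inequality give the strong bounds, the
    indicator of [s > alpha] and the martingale weak type (1,1) inequality give
    the constant 2.  For [B] on [L^1], only averages of [|f|] itself occur.

    On the homogeneous tree, if [f] is the Dirac mass at [o], the elements of
    the base of height [r.+1] that do not lie in the base of height [r] (both
    below an ancestor of [o]) contribute at least [1/2] to the [L^1] norm of
    [B^u f], for every [r]. *)

(** * The parent map of a tree with a ray *)

Lemma nat_min_exists (P : nat -> Prop) :
  (exists n, P n) -> exists n, P n /\ forall m, P m -> (n <= m)%N.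
Proof.
move=> [n Pn].
have ex : exists n, `[< P n >] by exists n; apply/asboolP.
case: (ex_minnP ex) => m /asboolP Pm mmin; exists m; split=> // k Pk.
by apply: mmin; apply/asboolP.
Qed.

Section tree_to_parent.
Context (V : pointedType) (adj : rel V).
Hypothesis tree : is_tree adj.

Let adjC : symmetric adj. Proof. by case: tree. Qed.
Let adjxx : irreflexive adj. Proof. by case: tree. Qed.

(** Shortening the walk from [y] to [y'] and closing it through [x] gives a cycle without repeated
    vertices. Acyclicity leaves room for two vertices only, so the shortened walk is empty. *)
Lemma no_detour (x y y' : V) (w : seq V) : adj x y -> adj x y' ->
  path adj y w -> last y w = y' -> x \notin y :: w -> y = y'.
Proof.
move=> xy xy' /shortenP[w' pw' uw' sub] lw xw.
case: tree => _ _ _ /(_ (x :: y :: w')) acyclic.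
have xw' : x \notin y :: w'.
  apply: contra xw; rewrite !inE => /orP[->//|/sub ->]; exact: orbT.
suff /acyclic : ucycle adj (x :: y :: w') by case: w' lw {pw' uw' sub xw' acyclic}.
apply/andP; split; last by rewrite cons_uniq xw' uw'.
by rewrite /= xy rcons_path pw' lw adjC.
Qed.

Lemma joined_by_cat (x y z : V) (m n : nat) :
  joined_by adj x y m -> joined_by adj y z n -> joined_by adj x z (m + n)%N.
Proof.
move=> [p [pp lp sp]] [q [pq lq sq]]; exists (p ++ q).
by rewrite cat_path last_cat size_cat lp pp pq lq sp sq.
Qed.

Lemma joined_by_adj (x y : V) : adj x y -> joined_by adj x y 1.
Proof. by move=> xy; exists [:: y]; rewrite /= xy. Qed.

Lemma gdistP (x y : V) : joined_by adj x y (gdist adj x y).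
Proof.
rewrite /gdist; case: xgetP => [n -> []//|none].
have [] := @nat_min_exists (joined_by adj x y).
  by case: tree => _ _ /(_ x y)[p ? ?] _; exists (size p), p.
by move=> n /none.
Qed.

Lemma gdist_min (x y : V) (m : nat) :
  joined_by adj x y m -> (gdist adj x y <= m)%N.
Proof.
rewrite /gdist; case: xgetP => [n -> [_ +]|none xy]; first exact.
have [] := @nat_min_exists (joined_by adj x y); first by exists m.
by move=> n /none.
Qed.

Lemma gdist_triangle (y x z : V) :
  (gdist adj x z <= gdist adj x y + gdist adj y z)%N.
Proof. by apply: gdist_min; exact: joined_by_cat (gdistP _ _) (gdistP _ _). Qed.

Lemma gdist_adj (x y z : V) : adj x y -> (gdist adj x z <= (gdist adj y z).+1)%N.
Proof.
move=> xy; apply: leq_trans (gdist_triangle y x z) _.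
by rewrite -add1n leq_add2r; apply: gdist_min; exact: joined_by_adj.
Qed.

(** By local finiteness, walks of length [n] from a base point reach finitely many vertices.
    Countability later turns integrals into sums. *)
Lemma tree_countable : locally_finite adj -> countable [set: V].
Proof.
move=> lf.
pose B n := [set y | joined_by adj point y n].
have -> : [set: V] = \bigcup_n B n.
  by apply/seteqP; split=> // y _; exists (gdist adj point y) => //; exact: gdistP.
apply: bigcup_countable => // n _; apply: finite_set_countable.
elim: n => [|n IH].
  apply: (sub_finite_set _ (finite_set1 point)) => y [p].
  by move=> [_ + /size0nil p0]; rewrite p0 => <-.
apply: (@sub_finite_set _ _ (\bigcup_(z in B n) neighbours adj z)).
  move=> y [p [+ + sp]]; case/lastP: p sp => // p z.
  rewrite size_rcons rcons_path last_rcons => -[sp] /andP[pp lz] <-.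
  by exists (last point p) => //; exists p.
by apply: bigcup_finite => // z _; exact: lf.
Qed.

(** * Heights along the ray *)

Section height.
Context (R : realType) (omega : nat -> V).
Hypothesis geo : geodesic_ray adj omega.

Lemma gdist_ray_succ (x : V) (m : nat) :
  (gdist adj x (omega m.+1) <= (gdist adj x (omega m)).+1)%N.
Proof.
apply: leq_trans (gdist_triangle (omega m) _ _) _.
by rewrite geo; lia.
Qed.

Lemma gdist_ray_add (x : V) (m k : nat) :
  (gdist adj x (omega (m + k)) <= gdist adj x (omega m) + k)%N.
Proof.
elim: k => [|k IH]; first by rewrite !addn0.
by rewrite !addnS; exact: leq_trans (gdist_ray_succ _ _) _.
Qed.

(** With [c] the distance from [omega 0] to [x], the number [c + u m - m] is nonnegative and
    nonincreasing in [m]. Once it attains its minimum [n] it is constant, and the height is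
    [c - n]. *)
Lemma height_eventually (x : V) : exists h : int,
  (exists N, forall m, (N <= m)%N -> m%:Z = h + (gdist adj x (omega m))%:Z) /\
  height adj R omega x = h%:~R.
Proof.
pose c := gdist adj (omega 0%N) x; pose u m := gdist adj x (omega m).
have cu m : (m <= c + u m)%N.
  have := gdist_triangle x (omega 0%N) (omega m); rewrite geo -/c -/(u m); lia.
have [] := @nat_min_exists (fun n => exists m, (c + u m - m)%N = n).
  by exists (c + u 0 - 0)%N, 0%N.
move=> n [[N uN] nmin].
have uE m : (N <= m)%N -> m%:Z = (c%:Z - n%:Z) + (u m)%:Z.
  move=> Nm; have := nmin _ (ex_intro _ m erefl).
  have := gdist_ray_add x N (m - N); rewrite subnKC// -/(u m) -/(u N).
  have := cu m; have := cu N; lia.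
exists (c%:Z - n%:Z); split; first by exists N.
apply: lim_near_cst; first exact: Rhausdorff.
near=> m.
rewrite -/(u m) !pmulrn -intrB; congr (_%:~R).
have Nm : (N <= m)%N by near: m; exact: nbhs_infty_ge.
by rewrite (uE m Nm) addrK.
Unshelve. all: by end_near. Qed.

Lemma tree_height : exists h : V -> int,
  [/\ forall x, height adj R omega x = (h x)%:~R,
      forall x, exists2 y, adj x y & h y = h x + 1,
      forall x y y', adj x y -> adj x y' -> h x <= h y -> h x <= h y' -> y = y'
    & forall x y, adj x y -> h y <= h x + 1].
Proof.
have [h hP] := choice height_eventually.
have hlt x y : adj x y -> h y <= h x + 1.
  move=> xy; have [[Nx uNx] _] := hP x; have [[Ny uNy] _] := hP y.
  have /uNx := leq_maxl Nx Ny; have /uNy := leq_maxr Nx Ny.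
  have := gdist_adj (omega (maxn Nx Ny)) xy; lia.
exists h; split=> //; first by move=> x; have [] := hP x.
- move=> x; have [[Nx uNx] _] := hP x.
  (* Since [m] exceeds the height of [x] in absolute value, [omega m] differs from [x], and a
     geodesic towards it has a first step [y]. *)
  pose m := maxn Nx `|h x|.+1; have := uNx m (leq_maxl _ _).
  have : (`|h x| < m)%N by exact: leq_maxr.
  have [[|y p] [/= + lp <-]] := gdistP x (omega m); first by lia.
  move=> /andP[xy pp] hm mE; exists y => //.
  suff : h x + 1 <= h y by have := hlt _ _ xy; lia.
  have ym : (gdist adj y (omega m) <= size p)%N by apply: gdist_min; exists p.
  have [[Ny uNy] _] := hP y.
  have := uNy (m + Ny)%N (leq_addl _ _); have := gdist_ray_add y m Ny; lia.
- move=> x y y' xy xy' hxy hxy'.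
  have [[Nx uNx] _] := hP x; have [[Ny uNy] _] := hP y.
  have [[Ny' uNy'] _] := hP y'.
  pose m := maxn Nx (maxn Ny Ny').
  have mx : m%:Z = h x + (gdist adj x (omega m))%:Z by apply: uNx; lia.
  have my : m%:Z = h y + (gdist adj y (omega m))%:Z by apply: uNy; lia.
  have my' : m%:Z = h y' + (gdist adj y' (omega m))%:Z by apply: uNy'; lia.
  (* a geodesic to a far point of the ray from a neighbour that is not below
     [x] avoids [x] *)
  have avoid z p : adj x z -> (gdist adj z (omega m) <= gdist adj x (omega m))%N ->
      path adj z p -> last z p = omega m -> size p = gdist adj z (omega m) ->
      x \notin z :: p.
    move=> xz dzx pp lp sp; apply/negP => xp.
    case/splitPl: xp pp lp sp => p1 p2 lp1.
    rewrite cat_path last_cat size_cat lp1 => /andP[_ pp2] lp2.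
    have : (gdist adj x (omega m) <= size p2)%N by apply: gdist_min; exists p2.
    case: p1 lp1 => [/= zx|? ? _ /=]; last by lia.
    by rewrite zx adjxx in xz.
  have [p [pp lp sp]] := gdistP y (omega m).
  have [q [pq lq sq]] := gdistP y' (omega m).
  have xp : x \notin y :: p by apply: avoid => //; lia.
  have xq : x \notin y' :: q by apply: avoid => //; lia.
  (* The walk goes from [y] up to [omega m] and back down to [y']; [belast] keeps the meeting point
     from occurring twice. *)
  apply: (@no_detour x y y' (p ++ rev (belast y' q))) => //.
  + rewrite cat_path pp lp -lq rev_path.
    by rewrite (eq_path (e' := adj)) // => ? ?; exact: adjC.
  + rewrite last_cat lp -lq; case: (q) => //= z s.
    by rewrite rev_cons last_rcons.
  + rewrite -cat_cons mem_cat negb_or xp/= mem_rev.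
    by apply: contra xq; exact: mem_belast.
Qed.

(** These properties, with countability, are all that the sequel retains of the tree and the ray.
    The predecessor of the degree appears because exactly one neighbour, the parent, is not a
    child. *)
Lemma tree_parent : locally_finite adj ->
  exists (par : V -> V) (ch : V -> seq V),
  [/\ forall x, uniq (ch x),
      forall x y, (y \in ch x) = (par y == x),
      forall x, size (ch x) = (degree adj x).-1
    & forall x, successors adj R omega x = [set` ch x]].
Proof.
move=> lf.
have [h [hE hup huniq hle]] := tree_height.
have [par parP] : exists par : V -> V, forall x, adj x (par x) /\ h (par x) = h x + 1.
  have /choice[par parP] x : exists y, adj x y /\ h y = h x + 1.
    by have [y ? ?] := hup x; exists y.
  by exists par.
have parE x y : adj x y -> h x <= h y -> y = par x.
  move=> xy hxy; have [xp hp] := parP x; apply: (huniq x) => //; lia.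
have succE x : successors adj R omega x = [set y | par y = x].
  apply/seteqP; split=> y /=.
    move=> [xy]; rewrite !hE => /eqP; rewrite -[1]/(1%:~R) -intrB eqr_int => /eqP hyx.
    by apply/esym/parE; [rewrite adjC|lia].
  move=> <-; have [yp hp] := parP y; split; first by rewrite adjC.
  by rewrite !hE hp intrD addrK.
have nE x : neighbours adj x = par x |` successors adj R omega x.
  apply/seteqP; split=> y /=.
    move=> xy; have [hxy|hyx] := leP (h x) (h y).
      by left; exact: parE.
    by right; rewrite succE/=; apply/esym/parE; [rewrite adjC|lia].
  by case=> [->|[]//]; have [] := parP x.
have fs x : finite_set (successors adj R omega x).
  by apply: sub_finite_set (lf x) => y; rewrite nE; right.
exists par, (fun x => enum_fset (fset_set (successors adj R omega x))); split.
- by move=> x; exact: fset_uniq.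
- move=> x y; rewrite in_fset_set// succE; apply/idP/eqP; by rewrite inE.
- move=> x; rewrite /degree nE fset_setU1// cardfsU1 in_fset_set//.
  rewrite memNset//= => -[_]; have [_ hp] := parP x.
  by rewrite !hE hp => /eqP; rewrite -[1]/(1%:~R) -intrB eqr_int; lia.
- by move=> x; apply/seteqP; split=> y /=; rewrite in_fset_set// inE.
Qed.

End height.

End tree_to_parent.

(** * Averages over descendants *)

Section powR_inequalities.
Context (R : realType) (p : R).
Hypothesis p_gt1 : 1 < p.
Let q := p / (p - 1).

Let q_gt1 : 1 < q.
Proof. by rewrite /q ltr_pdivlMr ?subr_gt0// mul1r gtrBl. Qed.

Let p_neq0 : p != 0.
Proof. by rewrite gt_eqF// (lt_trans ltr01). Qed.

Let p1_neq0 : p - 1 != 0.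
Proof. by rewrite gt_eqF// subr_gt0. Qed.

(** Young's inequality for the (p-1)-st power of [m] and for [x], with conjugate exponents [q] and
    [p], multiplied by [q]; here (p - 1) q = p and q / p = q - 1. *)
Lemma young_powR (m x : R) : 0 <= m -> 0 <= x ->
  q * m `^ (p - 1) * x <= m `^ p + (q - 1) * x `^ p.
Proof.
move=> m0 x0.
have pq : q^-1 + p^-1 = 1 by rewrite /q invf_div; field.
have q0 : 0 < q := lt_trans ltr01 q_gt1.
have := conjugate_powR (powR_ge0 m (p - 1)) x0 q0 (lt_trans ltr01 p_gt1) pq.
rewrite -powRrM (_ : (p - 1) * q = p); last by rewrite /q; field.
move=> /(ler_wpM2l (ltW q0)); rewrite mulrA => /le_trans; apply.
rewrite le_eqVlt; apply/orP; left; apply/eqP.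
by rewrite /q; field; apply/andP.
Qed.

(** If [x] exceeds [m], the left side is 1 - q times the p-th power of [x], and the claim is
    [young_powR]; otherwise both sides agree. *)
Lemma powR_max_sub (m x : R) : 0 <= m -> 0 <= x ->
  Num.max m x `^ p - q * Num.max m x `^ (p - 1) * x
    <= m `^ p - q * m `^ (p - 1) * x.
Proof.
move=> m0 x0; have [//|mx] := leP x m.
have := young_powR m0 x0.
have := mulr_powRB1 x0 (lt_trans ltr01 p_gt1).
by rewrite -(mulrA q (x `^ _)) [x `^ _ * x]mulrC => ->; lra.
Qed.

(** According to whether 2qx is at most [s], one of the two terms on the right suffices. The factor
    1/2 allows the power of [s] to be absorbed in [doob_desc]. *)
Lemma powR_absorb (s x : R) : 0 <= s -> 0 <= x ->
  q * s `^ (p - 1) * x <= 2^-1 * (s `^ p + (2 * q) `^ p * x `^ p).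
Proof.
move=> s0 x0; have p0 : 0 < p := lt_trans ltr01 p_gt1.
have p10 : 0 <= p - 1 by rewrite subr_ge0 ltW.
have q20 : 0 <= 2 * q by rewrite mulr_ge0// ltW// (lt_trans ltr01).
have qx0 : 0 <= 2 * q * x := mulr_ge0 q20 x0.
have [xs|sx] := leP (2 * q * x) s.
  have := mulr_ge0 (powR_ge0 (2 * q) p) (powR_ge0 x p).
  have := ler_wpM2l (powR_ge0 s (p - 1)) xs.
  rewrite -(mulr_powRB1 s0 p0); lra.
have : s `^ (p - 1) <= (2 * q * x) `^ (p - 1).
  by apply: ge0_ler_powR; rewrite ?nnegrE// ltW.
move=> /(ler_wpM2l qx0); rewrite mulr_powRB1// powRM//.
have := powR_ge0 s p; lra.
Qed.

End powR_inequalities.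

(** * Descendants and martingale maximal inequalities *)

Section forest.
Context (V : pointedType) (par : V -> V) (ch : V -> seq V).
Hypothesis ch_uniq : forall x, uniq (ch x).
Hypothesis mem_ch : forall x y, (y \in ch x) = (par y == x).

(** The recursion splits at the root, unlike that of [nsuccessors], so that inductions pass from a
    vertex to its children. *)
Fixpoint desc (k : nat) (x : V) : seq V :=
  if k is k'.+1 then flatten [seq desc k' y | y <- ch x] else [:: x].

Lemma mem_desc (k : nat) (x z : V) : (z \in desc k x) = (iter k par z == x).
Proof.
elim: k x => [|k IH] x; first by rewrite inE.
rewrite iterS -mem_ch; apply/flattenP/idP => [[_ /mapP[y yx ->]]|zx].
  by rewrite IH => /eqP ->.
by exists (desc k (iter k par z)); [exact: map_f|rewrite IH].
Qed.

Lemma desc_uniq (k : nat) (x : V) : uniq (desc k x).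
Proof.
elim: k x => [//|k IH] x /=.
elim: (ch x) (ch_uniq x) => [//|y s IHs] /= /andP[ys us].
rewrite cat_uniq IH IHs// andbT/=.
apply/hasPn => z /flattenP[_ /mapP[y' y's ->]]; rewrite mem_desc => /eqP zy'.
by apply: contra ys; rewrite mem_desc zy' => /eqP <-.
Qed.

Lemma sum_desc (M : nmodType) (k : nat) (x : V) (g : V -> M) :
  \sum_(z <- desc k.+1 x) g z = \sum_(y <- ch x) \sum_(z <- desc k y) g z.
Proof. by rewrite /= big_flatten big_map. Qed.

Lemma size_desc (b k : nat) (x : V) : (forall x, size (ch x) = b) ->
  size (desc k x) = (b ^ k)%N.
Proof.
move=> chb; elim: k x => [//|k IH] x /=.
rewrite size_flatten /shape -map_comp sumnE big_map.
under eq_bigr do rewrite /= IH.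
by rewrite big_const_seq count_predT iter_addn_0 chb expnSr.
Qed.

Lemma size_desc_ge (b k : nat) (x : V) : (forall x, (b <= size (ch x))%N) ->
  (b ^ k <= size (desc k x))%N.
Proof.
move=> chb; elim: k x => [//|k IH] x /=.
rewrite size_flatten /shape -map_comp sumnE big_map.
apply: (@leq_trans (\sum_(y <- ch x) b ^ k)); last by apply: leq_sum => y _; exact: IH.
by rewrite big_const_seq count_predT iter_addn_0 expnSr leq_mul2l chb orbT.
Qed.

Section averages.
Context (R : realType) (F : V -> R).
Hypothesis F_ge0 : forall x, 0 <= F x.
Hypothesis ch_gt0 : forall x, (0 < size (ch x))%N.

Lemma size_desc_gt0 (k : nat) (x : V) : (0 < size (desc k x))%N.
Proof. by have := @size_desc_ge 1 k x ch_gt0; rewrite exp1n. Qed.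

Definition davg (r : nat) (y : V) : R :=
  (\sum_(w <- desc r y) F w) / (size (desc r y))%:R.

Lemma davg_ge0 r y : 0 <= davg r y.
Proof. by rewrite divr_ge0// sumr_ge0. Qed.

Lemma sum_davg r y : \sum_(w <- desc r y) F w = (size (desc r y))%:R * davg r y.
Proof. by rewrite mulrC divfK// pnatr_eq0 -lt0n size_desc_gt0. Qed.

(** The martingale maximal function at [z], restricted to the bases of height at most [N] that
    contain [z]. *)
Fixpoint smax (N : nat) (z : V) : R :=
  if N is N'.+1 then Num.max (davg N (iter N par z)) (smax N' z) else F z.

Lemma smax_ge0 N z : 0 <= smax N z.
Proof. by case: N => [|N] /=; rewrite ?le_max ?davg_ge0. Qed.

Lemma smax_le N z : smax N z <= smax N.+1 z.
Proof. by rewrite /= le_max lexx orbT. Qed.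

Lemma davg_le_smax N z : davg N (iter N par z) <= smax N z.
Proof.
case: N => [|N]; last by rewrite /= le_max lexx.
by rewrite /davg big_seq1 divr1.
Qed.

Lemma smaxS_desc N y z : z \in desc N.+1 y ->
  smax N.+1 z = Num.max (davg N.+1 y) (smax N z).
Proof. by rewrite mem_desc => /eqP zy; rewrite -zy. Qed.

Lemma sum_smaxS (M : nmodType) N y (g : R -> V -> M) :
  \sum_(z <- desc N.+1 y) g (smax N.+1 z) z =
  \sum_(y' <- ch y) \sum_(z <- desc N y') g (Num.max (davg N.+1 y) (smax N z)) z.
Proof.
rewrite -sum_desc big_seq [RHS]big_seq.
by apply: eq_bigr => z zy; rewrite (smaxS_desc zy).
Qed.

Lemma weak_desc N y (alpha : R) : 0 < alpha ->
  alpha * \sum_(z <- desc N y) (alpha < smax N z)%R%:R <= \sum_(z <- desc N y) F z.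
Proof.
move=> a0; elim: N y => [|N IH] y.
  rewrite !big_seq1 /=; have := F_ge0 y; case: ltP => /=; lra.
(* Stopping at the root: if its average exceeds [alpha], the whole base can be counted; otherwise
   the root does not affect the event, and the bounds for the children add up. *)
have [ay|ya] := ltP alpha (davg N.+1 y).
  rewrite sum_davg mulrC ler_pM ?sumr_ge0 ?(ltW a0) ?(ltW ay)//.
  rewrite -sum1_size natr_sum ler_sum// => z _.
  by case: (_ < _).
rewrite (sum_smaxS _ _ (fun s _ => (alpha < s)%R%:R)) sum_desc mulr_sumr.
apply: ler_sum => y' _; apply: le_trans (IH y'); rewrite ler_pM2l//.
apply: ler_sum => z _; rewrite lt_max [alpha < davg _ _]ltNge ya/=.
by case: (_ < _).
Qed.

Section strong.
Context (p : R).
Hypothesis p_gt1 : 1 < p.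
Let q := p / (p - 1).

(* Doob's inequality is the case [m = 0] of a statement in which the running
   maximum starts at [m], so that it can be proved by induction on [N] from the
   root of the triangle; one step is [powR_max_sub]. *)
Lemma bellman N y (m : R) : 0 <= m ->
  \sum_(z <- desc N y) (Num.max m (smax N z) `^ p
      - q * Num.max m (smax N z) `^ (p - 1) * F z)
  <= (size (desc N y))%:R * m `^ p - q * m `^ (p - 1) * \sum_(z <- desc N y) F z.
Proof.
elim: N y m => [|N IH] y m m0.
  rewrite !big_seq1 /= mul1r; exact: powR_max_sub.
pose m' := Num.max m (davg N.+1 y).
have m'0 : 0 <= m' by rewrite le_max m0.
rewrite (sum_smaxS _ _ (fun s z => Num.max m s `^ p - q * Num.max m s `^ (p - 1) * F z)).
apply: (@le_trans _ _ ((size (desc N.+1 y))%:R * m' `^ p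
    - q * m' `^ (p - 1) * \sum_(z <- desc N.+1 y) F z)).
  rewrite sum_desc mulr_sumr -sum1_size natr_sum sum_desc mulr_suml -sumrB.
  apply: ler_sum => y' _; rewrite -natr_sum sum1_size.
  under eq_bigr do rewrite maxA; exact: IH.
rewrite sum_davg; have := powR_max_sub p_gt1 m0 (davg_ge0 N.+1 y).
rewrite -/m' -/q => /(ler_wpM2l (ler0n R (size (desc N.+1 y)))).
by rewrite !mulrBr ![_%:R * (_ * davg _ _)]mulrCA.
Qed.

(** Starting [bellman] at 0 bounds the sum of the powers of [smax] by a mixed sum with [F]. By
    [powR_absorb], half of the former sum, which is finite, reappears on the right and is
    subtracted. *)
Lemma doob_desc N y :
  \sum_(z <- desc N y) smax N z `^ p
    <= (2 * q) `^ p * \sum_(z <- desc N y) F z `^ p.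
Proof.
have p0 : p != 0 by rewrite gt_eqF// (lt_trans ltr01).
have p10 : p - 1 != 0 by rewrite gt_eqF// subr_gt0.
have := bellman N y (lexx 0).
rewrite !powR0// !(mulr0, mul0r) subrr.
under eq_bigr do rewrite max_r ?smax_ge0//.
rewrite sumrB subr_le0 => H.
suff : \sum_(z <- desc N y) q * smax N z `^ (p - 1) * F z <=
  2^-1 * (\sum_(z <- desc N y) smax N z `^ p
    + (2 * q) `^ p * \sum_(z <- desc N y) F z `^ p) by lra.
rewrite !mulr_sumr -big_split mulr_sumr; apply: ler_sum => z _.
by apply: powR_absorb => //; exact: smax_ge0.
Qed.

End strong.
End averages.
End forest.

(** * Sums over the vertices *)

Section counting_integral.
Context (R : realType) (V : pointedType).
Local Open Scope ereal_scope.
Local Notation mu := (vertex_measure R V).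

Hypothesis Vcount : countable [set: V].

Lemma integral_esum (D : set V) (g : V -> \bar R) : (forall x, 0 <= g x) ->
  \int[mu]_(x in D) g x = \esum_(x in D) g x.
Proof.
(* An injection into the naturals cuts [D] into countably many pieces with at most one point
   each. *)
move=> g0; have /countable_injP[e einj] := Vcount.
pose F n : set V := D `&` [set x | e x = n].
have DF : D = \bigcup_n F n.
  by apply/seteqP; split=> [x Dx|x [n _ []//]]; exists (e x).
have tF : trivIset setT F by move=> i j _ _ [x [[_ <-] [_ <-]]].
have intF n : \int[mu]_(x in F n) g x = \esum_(x in F n) g x.
  have [->|/set0P[x [Dx ex]]] := eqVneq (F n) set0.
    by rewrite integral_set0 esum_set0.
  have -> : F n = [set x].
    apply/seteqP; split=> [y [_ ey]|_ ->//]; apply: einj; rewrite ?inE//.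
    by rewrite ex ey.
  rewrite esum_set1//.
  rewrite (eq_integral (fun=> g x)); last by move=> y /set_mem ->.
  rewrite integral_cst//= /counting asboolT ?finite_set1//.
  by rewrite fset_set1 cardfs1 mule1.
rewrite DF [RHS]nneseries_sum_bigcup// ge0_integral_bigcup//.
by apply: eq_eseriesr => n _; exact: intF.
Qed.

Lemma esum_seq (s : seq V) (g : V -> \bar R) : uniq s -> (forall x, 0 <= g x) ->
  \esum_(x in [set` s]) g x = \sum_(x <- s) g x.
Proof. by move=> us g0; rewrite esum_fset //= -?fsbig_seq //; exact: finite_seq. Qed.

Lemma integral_seq (s : seq V) (g : V -> \bar R) : uniq s -> (forall x, 0 <= g x) ->
  \int[mu]_(x in [set` s]) g x = \sum_(x <- s) g x.
Proof. by move=> us g0; rewrite integral_esum// esum_seq. Qed.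

Lemma vertex_measure_seq (s : seq V) : uniq s ->
  mu [set` s] = (size s)%:R%:E.
Proof.
move=> us; rewrite -[LHS]mul1e -integral_cst// integral_seq//.
by rewrite sumEFin big_const_seq count_predT iter_addr_0.
Qed.

End counting_integral.

(** * Averages over descendants, summed over all vertices *)

Section forest_integral.
Context (R : realType) (V : pointedType) (par : V -> V) (ch : V -> seq V).
Hypothesis ch_uniq : forall x, uniq (ch x).
Hypothesis mem_ch : forall x y, (y \in ch x) = (par y == x).
Hypothesis Vcount : countable [set: V].
Local Open Scope ereal_scope.
Local Notation mu := (vertex_measure R V).
Local Notation desc := (desc ch).

(** Each [z] is a [k]-th descendant of exactly one vertex, [iter k par z], so the double sum meets
    it once. *)
Lemma integral_desc (k : nat) (g : V -> \bar R) : (forall x, 0 <= g x) ->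
  \int[mu]_x (\sum_(z <- desc k x) g z) = \int[mu]_x g x.
Proof.
move=> g0; rewrite !integral_esum//; last by move=> x; exact: sume_ge0.
transitivity (\esum_(x in [set: V]) \esum_(z in [set` desc k x]) g z).
  by apply: eq_esum => x _; rewrite esum_seq//; exact: (desc_uniq ch_uniq mem_ch).
rewrite esum_esum//; apply/esym/reindex_esum; split.
- by [].
- move=> [x z] [x' z']; rewrite !inE/= !(mem_desc mem_ch).
  by move=> [_ /eqP <-] [_ /eqP <-] ->.
- move=> z _; exists (iter k par z, z) => //=; split=> //=.
  by rewrite (mem_desc mem_ch).
Qed.

Hypothesis ch_ge2 : forall x, (2 <= size (ch x))%N.

Definition desc_avg_series (g : V -> \bar R) (x : V) : \bar R :=
  \sum_(k <oo) ((size (desc k x))%:R^-1)%:E * \sum_(z <- desc k x) g z.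

Lemma integral_desc_avg_series (g : V -> \bar R) : (forall x, 0 <= g x) ->
  \int[mu]_x desc_avg_series g x <= 2%:E * \int[mu]_x g x.
Proof.
move=> g0.
have t0 k x : 0 <= ((size (desc k x))%:R^-1)%:E * \sum_(z <- desc k x) g z.
  by rewrite mule_ge0 ?sume_ge0// lee_fin invr_ge0.
rewrite integral_nneseries//.
have I0 : 0 <= \int[mu]_x g x by exact: integral_ge0.
(* The factor 2^-k is written in the form expected by [epsilon_trick0], which bounds its series by
   2. *)
apply: (@le_trans _ _ (\sum_(k <oo) (2 / (2 ^ k.+1)%:R)%:E * \int[mu]_x g x)).
  apply: lee_nneseries => [k _ _|k _]; first exact: integral_ge0.
  rewrite -(integral_desc k)// -ge0_integralZl//; last first.
    by move=> x _; exact: sume_ge0.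
  apply: ge0_le_integral => // x _.
  rewrite lee_wpmul2r ?sume_ge0// lee_fin expnS natrM invfM mulrA divff// mul1r.
  rewrite lef_pV2 ?posrE ?ltr0n ?expn_gt0//; last first.
    by apply: leq_trans (size_desc_ge k x ch_ge2); rewrite expn_gt0.
  by rewrite ler_nat; exact: size_desc_ge.
have [Ioo|Ifin] := eqVneq (\int[mu]_x g x) +oo.
  by rewrite Ioo gt0_muley// leey.
have [r rE] : exists r, \int[mu]_x g x = r%:E.
  by exists (fine (\int[mu]_x g x)); rewrite fineK// ge0_fin_numE// ltey.
rewrite rE in I0 *; under eq_eseriesr do rewrite muleC.
rewrite nneseriesZl// muleC lee_wpmul2r//.
exact: (epsilon_trick0 xpredT).
Qed.

Section maximal.
Context (F : V -> R).
Hypothesis F_ge0 : forall x, (0 <= F x)%R.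
Local Notation smax := (smax par ch F).
Local Notation davg := (davg ch F).

(** The supremum is taken after [phi], so that [phi] acts on real numbers even where [smax] is
    unbounded in [N]. *)
Definition smax_sup (phi : R -> R) (z : V) : \bar R :=
  ereal_sup (range (fun N => (phi (smax N z))%:E)).

Section phi.
Context (phi : R -> R).
Hypothesis phi_ge0 : forall s, (0 <= phi s)%R.
Hypothesis phi_le : forall s t, (0 <= s)%R -> (s <= t)%R -> (phi s <= phi t)%R.

Lemma smax_sup_ge0 z : 0 <= smax_sup phi z.
Proof.
by apply: le_ereal_sup_tmp; exists (phi (smax 0%N z))%:E; [exists 0%N|rewrite lee_fin].
Qed.

Lemma smax_homo z : {homo smax^~ z : m n / (m <= n)%N >-> (m <= n)%R}.
Proof.
apply: homo_leq => //; first exact: le_trans.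
by move=> n; exact: smax_le.
Qed.

(** Monotone convergence in [N] reduces the claim to one [N]; there [integral_desc] groups the
    vertices by their [N]-th ancestor, and the hypothesis applies to each group. *)
Lemma integral_smax_sup (psi : V -> R) (K : R) :
  (0 <= K)%R -> (forall x, (0 <= psi x)%R) ->
  (forall N y, (\sum_(z <- desc N y) phi (smax N z)
     <= K * \sum_(z <- desc N y) psi z)%R) ->
  \int[mu]_x smax_sup phi x <= K%:E * \int[mu]_x (psi x)%:E.
Proof.
move=> K0 psi0 HK; pose g N (x : discrete_space V) := (phi (smax N x))%:E.
have gnd x : {homo g^~ x : m n / (m <= n)%N >-> m <= n}.
  move=> m n mn; rewrite lee_fin phi_le ?smax_ge0//; exact: smax_homo.
have -> : \int[mu]_x smax_sup phi x = \int[mu]_x limn (g^~ x).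
  apply: eq_integral => x _; apply/esym/cvg_lim => //.
  exact: ereal_nondecreasing_cvgn.
rewrite monotone_convergence//; last by move=> n x _; rewrite lee_fin.
apply: lime_le.
  apply: ereal_nondecreasing_is_cvgn => m n mn.
  apply: ge0_le_integral => // x _; [by rewrite lee_fin|exact: gnd].
apply: nearW => N.
have gE : \int[mu]_x (\sum_(z <- desc N x) g N z) = \int[mu]_x g N x.
  by apply: integral_desc => x; rewrite lee_fin.
have psiE : \int[mu]_x (\sum_(z <- desc N x) (psi z)%:E) = \int[mu]_x (psi x)%:E.
  by apply: integral_desc => x; rewrite lee_fin.
rewrite -gE -psiE.
rewrite -ge0_integralZl//; last first.
  by move=> x _; apply: sume_ge0 => z _; rewrite lee_fin.
apply: ge0_le_integral => // x _; first by apply: sume_ge0 => z _; rewrite lee_fin.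
by rewrite !sumEFin -EFinM lee_fin.
Qed.

Lemma davg_le_series (j r : nat) (x : V) : (j <= r)%N ->
  (phi (davg r (iter j par x)))%:E <= desc_avg_series (smax_sup phi) x.
Proof.
(* [k] is the number of levels from [x] down to the base; only the [k]-th term of the series is
   kept. *)
move=> jr; pose k := (r - j)%N; pose y := iter j par x.
have sz : (0 < size (desc k x))%N.
  by apply: leq_trans (size_desc_ge k x ch_ge2); rewrite expn_gt0.
have u0 n : 0 <= ((size (desc n x))%:R^-1)%:E * \sum_(z <- desc n x) smax_sup phi z.
  by rewrite mule_ge0 ?lee_fin ?invr_ge0// sume_ge0// => z _; exact: smax_sup_ge0.
apply: (@le_trans _ _
  (((size (desc k x))%:R^-1)%:E * \sum_(z <- desc k x) smax_sup phi z)); last first.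
  apply: le_trans (nneseries_lim_ge k.+1 (fun n _ _ => u0 n)).
  by rewrite big_nat_recr//= leeDr// sume_ge0.
apply: (@le_trans _ _ (((size (desc k x))%:R^-1)%:E
    * \sum_(z <- desc k x) (phi (davg r y))%:E)).
  rewrite sumEFin -EFinM lee_fin big_const_seq count_predT iter_addr_0.
  by rewrite -[X in (_ * X)%R]mulr_natl mulKf// pnatr_eq0 -lt0n.
rewrite lee_wpmul2l ?lee_fin ?invr_ge0// big_seq [leRHS]big_seq.
apply: lee_sum => z; rewrite (mem_desc mem_ch) => /eqP zx.
apply: le_ereal_sup_tmp; exists (phi (smax r z))%:E; first by exists r.
rewrite lee_fin phi_le ?davg_ge0// /y -zx -iterD subnKC//.
exact: davg_le_smax.
Qed.

End phi.
End maximal.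
End forest_integral.

(** * The maximal operators *)

Lemma lee_poweR (R : realType) (r : R) (x y : \bar R) :
  0 <= r -> (0 <= x -> x <= y -> x `^ r <= y `^ r)%E.
Proof.
move=> r0 x0 xy; apply: gt0_ler_poweR => //; rewrite in_itv/= leey andbT//.
exact: le_trans xy.
Qed.

Section maximal_operators.
Context (R : realType) (V : pointedType) (adj : rel V) (omega : nat -> V).
Context (par : V -> V) (ch : V -> seq V).
Hypothesis ch_uniq : forall x, uniq (ch x).
Hypothesis mem_ch : forall x y, (y \in ch x) = (par y == x).
Hypothesis succE : forall x, successors adj R omega x = [set` ch x].
Hypothesis Vcount : countable [set: V].
Hypothesis ch_ge2 : forall x, (2 <= size (ch x))%N.
Local Open Scope ereal_scope.
Local Notation mu := (vertex_measure R V).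
Local Notation base := (base_maximal adj omega).
Local Notation uncentred := (uncentred_base_maximal adj omega).
Implicit Types f : V -> R.
Local Notation absf f := (fun w => `|f w|%R).

Let ch_gt0 x : (0 < size (ch x))%N.
Proof. exact: ltnW. Qed.

Lemma nsuccessorsE k x : nsuccessors adj R omega k x = [set` desc ch k x].
Proof.
have -> : [set` desc ch k x] = [set z | iter k par z = x].
  by apply/seteqP; split=> z /=; rewrite (mem_desc mem_ch) => /eqP.
elim: k => [|k IH] //=; rewrite IH; apply/seteqP; split=> z.
  by move=> [y /= <-]; rewrite succE/= mem_ch -iterS iterSr => /eqP ->.
by rewrite /= -iterS iterSr => <-; exists (par z) => //; rewrite succE/= mem_ch.
Qed.

Lemma triangleE r y x :
  triangle adj R omega r y x <-> exists2 j, (j <= r)%N & y = iter j par x.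
Proof.
split=> -[j jr]; first by rewrite nsuccessorsE/= (mem_desc mem_ch) => /eqP <-; exists j.
by move=> ->; exists j => //; rewrite nsuccessorsE/= (mem_desc mem_ch).
Qed.

Lemma averageE f k x :
  average f (nsuccessors adj R omega k x) = (davg ch (absf f) k x)%:E.
Proof.
have ud := desc_uniq ch_uniq mem_ch k x.
rewrite /average nsuccessorsE vertex_measure_seq// integral_seq//.
rewrite /davg inver pnatr_eq0 eqn0Ngt size_desc_gt0//=.
by rewrite sumEFin -EFinM mulrC.
Qed.

Lemma uncentred_le f x M :
  (forall j r, (j <= r)%N -> (davg ch (absf f) r (iter j par x))%:E <= M) ->
  uncentred f x <= M.
Proof.
move=> H; apply: ge_ereal_sup => _ [[y r] /= /triangleE[j jr ->] <-].
by rewrite averageE; exact: H.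
Qed.

Lemma davg_le_uncentred f x j r : (j <= r)%N ->
  (davg ch (absf f) r (iter j par x))%:E <= uncentred f x.
Proof.
move=> jr; apply: ereal_sup_ubound; exists (iter j par x, r); last exact: averageE.
by apply/triangleE; exists j.
Qed.

Lemma base_le f x M :
  (forall r, (davg ch (absf f) r x)%:E <= M) -> base f x <= M.
Proof. by move=> H; apply: ge_ereal_sup => _ [r _ <-]; rewrite averageE. Qed.

Lemma base_ge0 f x : 0 <= base f x.
Proof.
apply: le_ereal_sup_tmp; exists (davg ch (absf f) 0%N x)%:E.
  by exists 0%N => //; exact: averageE.
by rewrite lee_fin davg_ge0.
Qed.

Lemma base_le_uncentred f x : base f x <= uncentred f x.
Proof. by apply: base_le => r; exact: (@davg_le_uncentred f x 0%N r). Qed.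

Lemma smax_le_uncentred f N x :
  (smax par ch (absf f) N x)%:E <= uncentred f x.
Proof.
elim: N => [|N IH].
  have := @davg_le_uncentred f x 0%N 0%N isT.
  by rewrite /davg big_seq1 divr1.
rewrite /= EFin_max ge_max IH andbT -iterS; exact: davg_le_uncentred.
Qed.

Lemma uncentred_powR_bound (p : R) f : (1 < p)%R ->
  \int[mu]_x (uncentred f x `^ p) <=
  (2 * (2 * (p / (p - 1))) `^ p)%:E * \int[mu]_x (`|f x| `^ p)%:E.
Proof.
move=> p1; have p0 : (0 < p)%R := lt_trans ltr01 p1.
pose phi (s : R) := (s `^ p)%R.
have phi0 s : (0 <= phi s)%R by exact: powR_ge0.
have phi_le s t : (0 <= s)%R -> (s <= t)%R -> (phi s <= phi t)%R.
  move=> s0 st; apply: ge0_ler_powR; rewrite ?nnegrE// ?(ltW p0)//.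
  exact: le_trans st.
have absf0 x : (0 <= `|f x|)%R by [].
pose H := desc_avg_series ch (smax_sup par ch (absf f) phi).
have sup0 x : 0 <= smax_sup par ch (absf f) phi x by exact: smax_sup_ge0.
have H0 x : 0 <= H x.
  apply: nneseries_ge0 => k _ _.
  by rewrite mule_ge0 ?sume_ge0// lee_fin invr_ge0.
have unc0 x : 0 <= uncentred f x := le_trans (base_ge0 f x) (base_le_uncentred f x).
apply: (@le_trans _ _ (\int[mu]_x H x)).
  apply: ge0_le_integral => // x _; first exact: poweR_ge0.
  (* Taking the root of [H x] reduces the bound on the power of a supremum to a bound on each
     average. *)
  have -> : H x = (H x `^ p^-1) `^ p.
    by rewrite -poweRrM mulVf ?poweRe1// gt_eqF.
  apply: lee_poweR => //; first exact: ltW.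
  apply: uncentred_le => j r jr.
  have := davg_le_series mem_ch ch_ge2 absf0 phi0 phi_le x jr.
  have pV0 : (0 <= p^-1)%R by rewrite invr_ge0 ltW.
  rewrite -/H => /(lee_poweR pV0); rewrite lee_fin phi0 => /(_ isT).
  rewrite poweR_EFin -powRrM divff ?gt_eqF//.
  by rewrite powRr1// davg_ge0.
apply: le_trans (integral_desc_avg_series ch_uniq mem_ch Vcount ch_ge2 sup0) _.
rewrite EFinM -muleA lee_wpmul2l//.
apply: integral_smax_sup => //; first exact: powR_ge0.
by move=> N y; exact: doob_desc.
Qed.

(** Stated for any [S] dominated by the uncentred operator, so as to serve both maximal
    operators. *)
Lemma maximal_bounded_p (S : (V -> R) -> V -> \bar R) (p : R) : (1 < p)%R ->
  (forall f x, 0 <= S f x) -> (forall f x, S f x <= uncentred f x) ->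
  bounded_on_Lp p%:E S.
Proof.
move=> p1 S0 SU; have p0 : (0 < p)%R := lt_trans ltr01 p1.
exists ((2 * (2 * (p / (p - 1))) `^ p) `^ p^-1)%R => f _.
rewrite unlock /Lnorm.
have ix : \int[mu]_x (`|(EFin \o f) x| `^ p) = \int[mu]_x (`|f x| `^ p)%:E by [].
have c0 : (0 <= 2 * (2 * (p / (p - 1))) `^ p)%R by rewrite mulr_ge0// powR_ge0.
have pV0 : (0 <= p^-1)%R by rewrite invr_ge0 ltW.
rewrite -poweR_EFin -poweRM ?lee_fin//; last first.
  by apply: integral_ge0 => x _; exact: poweR_ge0.
apply: lee_poweR => //; first by apply: integral_ge0 => x _; exact: poweR_ge0.
rewrite ix; apply: le_trans (uncentred_powR_bound f p1).
apply: ge0_le_integral => // x _; first exact: poweR_ge0.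
by rewrite gee0_abs//; apply: lee_poweR => //; exact: ltW.
Qed.

Lemma maximal_bounded_oo (S : (V -> R) -> V -> \bar R) :
  (forall f x, 0 <= S f x) -> (forall f x, S f x <= uncentred f x) ->
  bounded_on_Lp +oo S.
Proof.
move=> S0 SU; exists 1%R => f _; rewrite mul1e unlock /Lnorm.
case: ifPn => // _; set M := ess_sup _ (abse \o (EFin \o f)).
(* Points have mass 1, so the essential bound holds at every vertex. *)
have fM x : `|f x|%:E <= M.
  have neg : mu.-negligible [set y | ~ `|f y|%:E <= M] :=
    ess_sup_ge mu (abse \o (EFin \o f)).
  apply: contrapT => fxM.
  have : mu [set x] = 0.
    by apply: measure_negligible => //; apply: negligibleS neg => y ->.
  rewrite (_ : [set x] = [set` [:: x]]) ?vertex_measure_seq//=.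
    by move=> /eqP; rewrite eqe oner_eq0.
  by apply/seteqP; split=> y /=; rewrite inE => /eqP.
apply/ess_supP/aeW => x /=; rewrite gee0_abs//.
apply: le_trans (SU f x) _; apply: uncentred_le => j r _.
case: M fM => [M| |] fM; rewrite ?leey//; last by have := fM x; rewrite leeNy_eq.
rewrite lee_fin /davg ler_pdivrMr ?ltr0n ?size_desc_gt0//.
rewrite mulr_natr -iter_addr_0 -count_predT -big_const_seq.
by apply: ler_sum => z _; rewrite -lee_fin.
Qed.

Lemma base_bounded_1 : bounded_on_Lp 1 (@base_maximal V adj R omega).
Proof.
exists 2%R => f _; rewrite !Lnorm1.
have f0 x : 0 <= `|f x|%:E by rewrite lee_fin.
apply: (@le_trans _ _ (\int[mu]_x desc_avg_series ch (fun x => `|f x|%:E) x)); last first.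
  have := integral_desc_avg_series ch_uniq mem_ch Vcount ch_ge2 f0. exact.
have t0 k x : 0 <= ((size (desc ch k x))%:R^-1)%:E * \sum_(z <- desc ch k x) `|f z|%:E.
  by rewrite mule_ge0 ?sume_ge0// lee_fin invr_ge0.
apply: ge0_le_integral => // x _.
(* The average over the base of height [r] below [x] is the [r]-th term of the series. *)
rewrite gee0_abs ?base_ge0//; apply: base_le => r.
apply: le_trans (nneseries_lim_ge r.+1 (fun n _ _ => t0 n x)).
rewrite big_nat_recr//= /davg mulrC EFinM -sumEFin leeDr//.
by rewrite sume_ge0.
Qed.

Lemma uncentred_weak (alpha : R) f : (0 < alpha)%R ->
  mu [set x | alpha%:E < uncentred f x] <= (2 / alpha)%:E * \int[mu]_x `|f x|%:E.
Proof.
move=> a0; pose phi (s : R) : R := ((alpha < s)%R%:R)%R.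
have phi0 s : (0 <= phi s)%R by [].
have phi_le s t : (0 <= s)%R -> (s <= t)%R -> (phi s <= phi t)%R.
  by move=> _ st; rewrite /phi ler_nat; case: ltP => // /lt_le_trans/(_ st) ->.
have absf0 x : (0 <= `|f x|)%R by [].
pose G := smax_sup par ch (absf f) phi.
have G0 x : 0 <= G x by exact: smax_sup_ge0.
pose E := [set x | alpha%:E < uncentred f x].
have EH : mu E <= \int[mu]_x desc_avg_series ch G x.
  have := @integral_indic _ _ _ mu setT measurableT E I; rewrite setIT => <-.
  apply: ge0_le_integral => // x _; rewrite indicE.
  have [/set_mem Ex|_] := boolP (x \in E); last first.
    apply: nneseries_ge0 => k _ _.
    by rewrite mule_ge0 ?sume_ge0// lee_fin invr_ge0.
  (* An average above [alpha] has [phi] equal to 1, so a series below 1 at [x] excludes [x] from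
     [E]. *)
  rewrite leNgt; apply/negP => lt1; move: Ex; rewrite /E/= ltNge => /negP; apply.
  apply: uncentred_le => j r jr; rewrite lee_fin leNgt; apply/negP => ad.
  have := davg_le_series mem_ch ch_ge2 absf0 phi0 phi_le x jr.
  by rewrite leNgt /phi ad lt1.
apply: le_trans EH _.
apply: le_trans (integral_desc_avg_series ch_uniq mem_ch Vcount ch_ge2 G0) _.
rewrite EFinM -muleA lee_wpmul2l//.
apply: integral_smax_sup => //; first by rewrite invr_ge0 ltW.
move=> N y; rewrite ler_pdivlMl//.
exact: weak_desc.
Qed.

End maximal_operators.

(** * Unboundedness on the homogeneous tree *)

Section homogeneous.
Context (R : realType) (V : pointedType) (par : V -> V) (ch : V -> seq V) (b : nat).
Hypothesis ch_uniq : forall x, uniq (ch x).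
Hypothesis mem_ch : forall x y, (y \in ch x) = (par y == x).
Hypothesis b_ge2 : (2 <= b)%N.
Hypothesis size_ch : forall x, size (ch x) = b.
Variable o : V.

Let F (w : V) : R := (w == o)%:R.

(** Among the children of the new root, the one leading to [o] gives the induction hypothesis. Each
    of the other b - 1 has b^r descendants in the base, where the average b^-(r+1) contributes 1/b
    in total; and (b - 1)/b is at least 1/2. *)
Lemma smax_dirac_lower r : r%:R / 2 <=
  \sum_(z <- desc ch r (iter r par o)) smax par ch F r z.
Proof.
have F0 x : 0 <= F x by [].
have ch0 x : (0 < size (ch x))%N by rewrite size_ch; exact: ltnW.
have sumF (s : seq V) : uniq s -> o \in s -> \sum_(w <- s) F w = 1.
  move=> us os; rewrite (bigD1_seq o)//= /F eqxx big1 ?addr0// => w wo.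
  by rewrite (negbTE wo).
elim: r => [|r IH].
  by rewrite mul0r sumr_ge0// => z _; exact: smax_ge0.
set y := iter r par o in IH *; rewrite iterS -/y.
have yc : y \in ch (par y) by rewrite mem_ch.
have dE : davg ch F r.+1 (par y) = (b ^ r.+1)%:R^-1.
  rewrite /davg (size_desc _ _ size_ch) sumF ?mul1r//.
    exact: (desc_uniq ch_uniq mem_ch).
  by rewrite (mem_desc mem_ch) iterS.
have b0 : (0 : R) < b%:R by rewrite ltr0n; exact: ltnW.
rewrite (sum_smaxS mem_ch F r (par y) (fun s _ => s)) (bigD1_seq y)//=.
have -> : r.+1%:R / 2 = r%:R / 2 + 2^-1 :> R by rewrite -natr1 mulrDl mul1r.
apply: lerD.
  apply: le_trans IH _; apply: ler_sum => z _.
  by rewrite le_max lexx orbT.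
apply: (@le_trans _ _ (\sum_(c <- ch (par y) | c != y) b%:R^-1)); last first.
  apply: ler_sum => c _.
  apply: (@le_trans _ _ (\sum_(z <- desc ch r c) (b ^ r.+1)%:R^-1)).
    rewrite big_const_seq count_predT iter_addr_0 (size_desc _ _ size_ch)//.
    rewrite -[leRHS]mulr_natl expnS natrM invfM mulrCA divff ?mulr1//.
    by rewrite pnatr_eq0 expn_eq0 negb_and -lt0n ltnW.
  by apply: ler_sum => z _; rewrite dE le_max lexx.
rewrite big_const_seq iter_addr_0 (_ : count _ _ = b.-1); last first.
  have := count_predC (pred1 y) (ch (par y)).
  by rewrite size_ch count_uniq_mem// yc => <-.
rewrite -[leRHS]mulr_natr ler_pdivlMl// -subn1 natrB ?(ltnW b_ge2)//.
have : (2 : R) <= b%:R by rewrite ler_nat.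
lra.
Qed.

End homogeneous.

Lemma uncentred_unbounded_1 (R : realType) (V : pointedType) (adj : rel V)
    (omega : nat -> V) (par : V -> V) (ch : V -> seq V) (b : nat) :
  (forall x, uniq (ch x)) -> (forall x y, (y \in ch x) = (par y == x)) ->
  (forall x, successors adj R omega x = [set` ch x]) -> countable [set: V] ->
  (2 <= b)%N -> (forall x, size (ch x) = b) ->
  ~ bounded_on_Lp 1%E (@uncentred_base_maximal V adj R omega).
Proof.
move=> ch_uniq mem_ch succE Vcount b2 size_ch [C HC].
have ch2 x : (2 <= size (ch x))%N by rewrite size_ch.
pose o : V := point; pose F (w : discrete_space V) : R := (w == o)%:R.
have FE : (fun w => `|F w|) = F by apply/funext => w; rewrite /F ger0_norm.
have Fint : ('N[vertex_measure R V]_1[EFin \o F] = 1)%E.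
  rewrite Lnorm1; transitivity (vertex_measure R V [set o]).
    rewrite -[[set o]]setIT -integral_indic//; apply: eq_integral => w _ /=.
    by rewrite indicE /F ger0_norm// in_set1.
  rewrite (_ : [set o] = [set` [:: o]]) ?vertex_measure_seq//.
  by apply/seteqP; split=> y /=; rewrite inE => /eqP.
have FL : F \in Lfun (vertex_measure R V) 1%E.
  by apply/andP; split; rewrite inE//= /finite_norm Fint ltry.
have := HC F FL; rewrite Fint mule1 Lnorm1.
set U := uncentred_base_maximal adj omega F.
have UE x r : ((smax par ch F r x)%:E <= U x)%E.
  rewrite -[in smax _ _ _ _ _]FE.
  exact: (smax_le_uncentred ch_uniq mem_ch succE Vcount ch2).
have F0 x : 0 <= F x by [].
have ch0 x : (0 < size (ch x))%N by rewrite size_ch; exact: ltnW.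
have lower r : ((r%:R / 2)%:E <= \int[vertex_measure R V]_x `|U x|)%E.
  pose s := desc ch r (iter r par o).
  apply: (@le_trans _ _ (\int[vertex_measure R V]_(x in [set` s]) `|U x|)%E); last first.
    exact: ge0_subset_integral.
  rewrite integral_seq//; last exact: (desc_uniq ch_uniq mem_ch).
  apply: le_trans (_ : (\sum_(z <- s) (smax par ch F r z)%:E <= _)%E); last first.
    by apply: lee_sum => z _; exact: le_trans (UE z r) (lee_abs _).
  by rewrite sumEFin lee_fin; exact: (smax_dirac_lower R ch_uniq mem_ch b2 size_ch o r).
(* The Dirac mass has norm 1, so [C] would bound r / 2 for every [r]. *)
move=> UC; have [r] : exists r : nat, C * 2 < r%:R.
  exists (Num.bound `|C * 2|).
  exact: le_lt_trans (ler_norm _) (archi_boundP (normr_ge0 _)).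
have := le_trans (lower r) UC; rewrite lee_fin ler_pdivrMr// => rC Cr.
by have := lt_le_trans Cr rC; rewrite ltxx.
Qed.

Theorem theorem3p2 (R : realType) :
  (forall (V : pointedType) (adj : rel V) (omega : nat -> V),
     is_tree adj -> locally_finite adj ->
     (forall x : V, (3 <= degree adj x)%N) ->
     geodesic_ray adj omega ->
     [/\ forall p : \bar R, (1 <= p)%E ->
           bounded_on_Lp p (@base_maximal V adj R omega),
         forall p : \bar R, (1 < p)%E ->
           bounded_on_Lp p (@uncentred_base_maximal V adj R omega)
       & forall (alpha : R) (f : discrete_space V -> R), 0 < alpha ->
           f \in Lfun (vertex_measure R V) 1%E ->
           (vertex_measure R V
              [set x | alpha%:E < uncentred_base_maximal adj omega f x]
            <= (2 / alpha)%:E * 'N[vertex_measure R V]_1[EFin \o f])%E])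
  /\
  (forall b : nat, (2 <= b)%N ->
   forall (V : pointedType) (adj : rel V) (omega : nat -> V),
     is_tree adj -> locally_finite adj ->
     (forall x : V, degree adj x = b.+1) ->
     geodesic_ray adj omega ->
     ~ bounded_on_Lp 1%E (@uncentred_base_maximal V adj R omega)).
Proof.
split=> [V adj omega tree lf deg geo|b b2 V adj omega tree lf deg geo].
  have Vcount := tree_countable tree lf.
  have [par [ch [ch_uniq mem_ch size_ch succE]]] := tree_parent tree R geo lf.
  have ch2 x : (2 <= size (ch x))%N.
    by rewrite size_ch -ltnS prednK// (leq_trans _ (deg x)).
  have ch0 x : (0 < size (ch x))%N by exact: ltnW.
  have b0 := base_ge0 ch_uniq mem_ch succE Vcount ch2.
  have bu := base_le_uncentred ch_uniq mem_ch succE Vcount ch2.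
  have u0 f x := le_trans (b0 f x) (bu f x).
  split=> [p|p|alpha f a0 _].
  - case: p => [p| |] // p1; last exact: (maximal_bounded_oo ch_uniq mem_ch succE).
    move: p1; rewrite lee_fin le_eqVlt => /predU1P[<-|p1].
      exact: (base_bounded_1 ch_uniq mem_ch succE).
    exact: (maximal_bounded_p ch_uniq mem_ch succE).
  - case: p => [p| |] // p1; last exact: (maximal_bounded_oo ch_uniq mem_ch succE).
    exact: (maximal_bounded_p ch_uniq mem_ch succE).
  - rewrite Lnorm1; exact: (uncentred_weak ch_uniq mem_ch succE).
have Vcount := tree_countable tree lf.
have [par [ch [ch_uniq mem_ch size_ch succE]]] := tree_parent tree R geo lf.
apply: (uncentred_unbounded_1 ch_uniq mem_ch succE Vcount b2) => x.
by rewrite size_ch deg.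
Qed.
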